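(* Let $S$ be an ai-semiring. Then $$\mathsf{V}(S) \leq \mathsf{V}(\mathbf{M}_{2}(S)) \leq \cdots \leq\mathsf{V}(\mathbf{M}_{n}(S))\leq \mathsf{V}(\mathbf{M}_{n+1}(S))\leq\cdots.$$
   Context: An ai-semiring (additively idempotent semiring) is an algebra $(S,+,\cdot)$ such that $(S,+)$ is a commutative idempotent semigroup, $(S,\cdot)$ is a semigroup, and $x(y+z)=xy+xz$, $(x+y)z=xz+yz$ hold (no additive or multiplicative identity element is required). For an ai-semiring $S$ and $n\ge 2$, $\mathbf{M}_n(S)$ is the ai-semiring of all $n\times n$ matrices over $S$ with entrywise addition and product $(AB)_{ij}=\sum_{k=1}^n A_{ik}B_{kj}$. A variety of ai-semirings is a class of ai-semirings closed under subalgebras, homomorphic images and arbitrary direct products. $\mathsf{V}(S)$ denotes the smallest variety containing $S$. For varieties, $\mathcal{W}\leq\mathcal{V}$ means that $\mathcal{W}$ is contained in $\mathcal{V}$. *)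

(* Defs.v *)
From HB Require Import structures.
From mathcomp Require Import all_boot ssralg matrix.
From mathcomp Require Import boolp classical_sets.

Set Implicit Arguments.
Unset Strict Implicit.
Unset Printing Implicit Defensive.

Import Algebra.

Local Open Scope ring_scope.

Local Notation "x * y" := (mul x y) : ring_scope.

(* Multiplication is that of semigroupType, not GRing.mul.  As usual in
   universal algebra, carriers are nonempty. *)
HB.mixin Record isAiSemiring S of AddSemigroup S & Semigroup S := {
  addxx : idempotent_op (@add S);
  ai_mulDr : right_distributive (@mul S) (@add S);
  ai_mulDl : left_distributive (@mul S) (@add S);
  ai_inhabited : inhabited S
}.

#[short(type="aiSemiringType")]
HB.structure Definition AiSemiring :=
  {S of isAiSemiring S & AddSemigroup S & Semigroup S}.

Definition ai_hom (S T : aiSemiringType) (f : S -> T) : Prop :=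
  {morph f : x y / x + y} /\ {morph f : x y / x * y}.

Section Subalgebra.
Variables (S : aiSemiringType) (A : set S).

Definition subalg : Prop :=
  [/\ (exists x, A x), (forall x y, A x -> A y -> A (x + y))
    & (forall x y, A x -> A y -> A (x * y))].

Definition subalg_type of subalg : Type := set_type A.

Hypothesis hA : subalg.
Local Notation U := (subalg_type hA).

HB.instance Definition _ := Choice.copy U (set_type A).

Let addU (x y : U) : U :=
  exist _ (val x + val y)
    (mem_set (let: And3 _ hD _ := hA in hD _ _ (set_valP x) (set_valP y))).
Let mulU (x y : U) : U :=
  exist _ (val x * val y)
    (mem_set (let: And3 _ _ hM := hA in hM _ _ (set_valP x) (set_valP y))).

Let addUC : commutative addU.
Proof. by move=> x y; apply: val_inj; exact: addrC. Qed.
Let addUA : associative addU.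
Proof. by move=> x y z; apply: val_inj; exact: addrA. Qed.
Let mulUA : associative mulU.
Proof. by move=> x y z; apply: val_inj; exact: mulgA. Qed.
Let addUU : idempotent_op addU.
Proof. by move=> x; apply: val_inj; exact: addxx. Qed.
Let mulUDr : right_distributive mulU addU.
Proof. by move=> x y z; apply: val_inj; exact: ai_mulDr. Qed.
Let mulUDl : left_distributive mulU addU.
Proof. by move=> x y z; apply: val_inj; exact: ai_mulDl. Qed.
Let inhU : inhabited U.
Proof. by have [[x Ax] _ _] := hA; split; exact: (exist _ x (mem_set Ax)). Qed.

HB.instance Definition _ := isAddSemigroup.Build U addUC addUA.
HB.instance Definition _ := isSemigroup.Build U mulUA.
HB.instance Definition _ := isAiSemiring.Build U addUU mulUDr mulUDl inhU.
End Subalgebra.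

Section Product.
Variables (I : Type) (S : I -> aiSemiringType).

Definition ai_prod : Type := forall i, S i.
Local Notation P := ai_prod.

HB.instance Definition _ := Choice.copy P (forall i, S i).

Let addP (x y : P) : P := fun i => x i + y i.
Let mulP (x y : P) : P := fun i => x i * y i.

Let addPC : commutative addP.
Proof. by move=> x y; apply: functional_extensionality_dep => i; exact: addrC. Qed.
Let addPA : associative addP.
Proof. by move=> x y z; apply: functional_extensionality_dep => i; exact: addrA. Qed.
Let mulPA : associative mulP.
Proof. by move=> x y z; apply: functional_extensionality_dep => i; exact: mulgA. Qed.
Let addPP : idempotent_op addP.
Proof. by move=> x; apply: functional_extensionality_dep => i; exact: addxx. Qed.
Let mulPDr : right_distributive mulP addP.
Proof. by move=> x y z; apply: functional_extensionality_dep => i; exact: ai_mulDr. Qed.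
Let mulPDl : left_distributive mulP addP.
Proof. by move=> x y z; apply: functional_extensionality_dep => i; exact: ai_mulDl. Qed.
Let inhP : inhabited P.
Proof.
have ex i : exists x : S i, True by case: (@ai_inhabited (S i)) => x; exists x.
by split=> i; exact: sval (cid (ex i)).
Qed.

HB.instance Definition _ := isAddSemigroup.Build P addPC addPA.
HB.instance Definition _ := isSemigroup.Build P mulPA.
HB.instance Definition _ := isAiSemiring.Build P addPP mulPDr mulPDl inhP.
End Product.

Section NonemptySum.
Variable S : aiSemiringType.

(* The sum of F over the finite type I, nonempty since i0 : I; there being no
   zero, the term at i0 is the starting value.  Its value does not depend on
   i0 (nesum_irr). *)
Definition nesum (I : finType) (i0 : I) (F : I -> S) : S :=
  \big[+%R/F i0]_(i | i != i0) F i.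

(* x + y = y is the semilattice order; nesum is the least upper bound. *)
Lemma nesum_lub (I : finType) (i0 : I) (F : I -> S) y :
  nesum i0 F + y = y <-> forall i, F i + y = y.
Proof.
have H (r : seq I) : \big[+%R/F i0]_(i <- r | i != i0) F i + y = y <->
    F i0 + y = y /\ forall i, i \in r -> F i + y = y.
  elim: r => [|j r IH]; first by rewrite big_nil; split=> [|[]].
  rewrite big_cons; case: eqP => [->|_] /=.
    rewrite IH; split=> -[h0 h]; split=> // i; first last.
      by move=> ir; apply: h; rewrite inE ir orbT.
    by rewrite inE => /predU1P[->|/h].
  split=> [h|[h0 h]].
    have hj : F j + y = y by rewrite -h !addrA addxx.
    have : \big[+%R/F i0]_(i <- r | i != i0) F i + y = y.
      by rewrite -[in LHS]h [F j + _]addrC !addrA addxx -!addrA hj -{2}h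
        -addrA addrCA hj.
    by case/IH=> h0 h'; split=> // i; rewrite inE => /predU1P[->|/h'].
  rewrite -addrA.
  have -> : \big[+%R/F i0]_(i <- r | i != i0) F i + y = y.
    by apply/IH; split=> // i ir; apply: h; rewrite inE ir orbT.
  by apply: h; rewrite mem_head.
split=> [/H[_ h] i|h]; first by apply: h; rewrite mem_index_enum.
by apply/H.
Qed.

Lemma lub_eq (x y : S) : (forall z, x + z = z <-> y + z = z) -> x = y.
Proof.
move=> h; have /h hx := addxx x; have /h hy := addxx y.
by rewrite -hx addrC.
Qed.

Lemma nesum_irr (I : finType) (i0 i1 : I) (F : I -> S) :
  nesum i0 F = nesum i1 F.
Proof. by apply: lub_eq => z; rewrite !nesum_lub. Qed.

Lemma nesumMr (I : finType) (i0 : I) (F : I -> S) x :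
  x * nesum i0 F = nesum i0 (fun i => x * F i).
Proof. by rewrite /nesum; apply: big_morph => //; exact: ai_mulDr. Qed.

Lemma nesumMl (I : finType) (i0 : I) (F : I -> S) x :
  nesum i0 F * x = nesum i0 (fun i => F i * x).
Proof.
by rewrite /nesum; apply: (big_morph (fun z => z * x)) => // y z; exact: ai_mulDl.
Qed.
End NonemptySum.

Section Matrices.
Variables (S : aiSemiringType) (n : nat).

(* An alias of 'M[S]_n, whose library addition and product require a zero. *)
Definition ai_matrix : Type := 'M[S]_n.
Local Notation M := ai_matrix.

HB.instance Definition _ := Choice.copy M 'M[S]_n.

Let addM (A B : M) : M := \matrix_(i, j) (A i j + B i j).
Let mulM (A B : M) : M :=
  \matrix_(i, j) nesum i (fun k => A i k * B k j).

Let addMC : commutative addM.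
Proof. by move=> A B; apply/matrixP => i j; rewrite !mxE addrC. Qed.
Let addMA : associative addM.
Proof. by move=> A B C; apply/matrixP => i j; rewrite !mxE addrA. Qed.
Let mulMA : associative mulM.
Proof.
move=> A B C; apply/matrixP => i j; rewrite !mxE; apply: lub_eq => z.
rewrite !nesum_lub; split=> h k.
  rewrite mxE nesumMl nesum_lub => l.
  by move: (h l); rewrite mxE nesumMr nesum_lub => /(_ k); rewrite mulgA.
rewrite mxE nesumMr nesum_lub => l.
by move: (h l); rewrite mxE nesumMl nesum_lub => /(_ k); rewrite mulgA.
Qed.
Let addMM : idempotent_op addM.
Proof. by move=> A; apply/matrixP => i j; rewrite !mxE addxx. Qed.

Let nesumD (i0 : 'I_n) (F G : 'I_n -> S) :
  nesum i0 (fun i => F i + G i) = nesum i0 F + nesum i0 G.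
Proof.
have D (x y z : S) : (x + y) + z = z <-> x + z = z /\ y + z = z.
  split=> [h|[hx hy]]; last by rewrite -addrA hy.
  split; first by rewrite -h !addrA addxx.
  by rewrite -h [x + y]addrC !addrA addxx.
apply: lub_eq => z; rewrite D !nesum_lub; split=> [h|[hF hG] i].
  by split=> i; case/D: (h i).
by apply/D.
Qed.

Let mulMDr : right_distributive mulM addM.
Proof.
move=> A B C; apply/matrixP => i j; rewrite !mxE -nesumD; congr nesum.
by apply: funext => k; rewrite mxE ai_mulDr.
Qed.
Let mulMDl : left_distributive mulM addM.
Proof.
move=> A B C; apply/matrixP => i j; rewrite !mxE -nesumD; congr nesum.
by apply: funext => k; rewrite mxE ai_mulDl.
Qed.
Let inhM : inhabited M.
Proof. by case: (@ai_inhabited S) => x; split; exact: (const_mx x). Qed.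

HB.instance Definition _ := isAddSemigroup.Build M addMC addMA.
HB.instance Definition _ := isSemigroup.Build M mulMA.
HB.instance Definition _ := isAiSemiring.Build M addMM mulMDr mulMDl inhM.
End Matrices.

Lemma subalg_addE (S : aiSemiringType) (A : set S) (hA : subalg A)
  (x y : subalg_type hA) : val (x + y) = val x + val y.
Proof. by []. Qed.

Lemma subalg_mulE (S : aiSemiringType) (A : set S) (hA : subalg A)
  (x y : subalg_type hA) : val (x * y) = val x * val y.
Proof. by []. Qed.

Lemma ai_prod_addE I (S : I -> aiSemiringType) (x y : ai_prod S) i :
  (x + y) i = x i + y i.
Proof. by []. Qed.

Lemma ai_prod_mulE I (S : I -> aiSemiringType) (x y : ai_prod S) i :
  (x * y) i = x i * y i.
Proof. by []. Qed.

Lemma ai_matrix_addE (S : aiSemiringType) n (A B : ai_matrix S n) i j :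
  (A + B) i j = A i j + B i j.
Proof. by rewrite mxE. Qed.

Lemma ai_matrix_mulE (S : aiSemiringType) n (A B : ai_matrix S n) i j :
  (A * B) i j = nesum i (fun k => A i k * B k j).
Proof. by rewrite mxE. Qed.

Definition ai_class := aiSemiringType -> Prop.

Record variety (C : ai_class) : Prop := Variety {
  variety_sub : forall (S : aiSemiringType) (A : set S) (hA : subalg A),
    C S -> C (subalg_type hA);
  variety_img : forall (S T : aiSemiringType) (f : S -> T),
    ai_hom f -> (forall y, exists x, f x = y) -> C S -> C T;
  variety_prod : forall (I : Type) (S : I -> aiSemiringType),
    (forall i, C (S i)) -> C (ai_prod S)
}.

Definition class_le (C D : ai_class) : Prop := forall T, C T -> D T.

Definition Var (S : aiSemiringType) : ai_class :=
  fun T => forall C, variety C -> C S -> C T.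

Lemma Var_variety S : variety (Var S).
Proof.
split=> [T A hA hT|T U f hf sf hT|I T hT] C vC CS.
- by apply: variety_sub => //; exact: hT.
- by apply: (variety_img vC hf sf); exact: hT.
- by apply: variety_prod => // i; exact: hT.
Qed.

Lemma Var_self S : Var S S.
Proof. by []. Qed.

Lemma Var_smallest S C : variety C -> C S -> class_le (Var S) C.
Proof. by move=> vC CS T; exact. Qed.

(* Main.v *)
Require Import Defs.
From mathcomp Require Import all_boot.
From mathcomp Require Import ssralg matrix boolp classical_sets.

Set Implicit Arguments.
Unset Strict Implicit.
Unset Printing Implicit Defensive.

Import Algebra.

Local Open Scope ring_scope.

(** M_n(S) embeds into M_m(S) whenever m >= n >= 1, even though S has no zero
    to pad with: a surjection s from the m indices onto the n indices sends A
    to the matrix with entries A_{s(i) s(j)}.  Repeated indices only repeat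
    summands in the product, which idempotency of addition absorbs.
    In the same way S embeds into M_n(S) as the constant matrices. *)

(** The inverse of [f] maps the subalgebra [range f] of [T] homomorphically onto [S]. *)
Lemma class_le_Var_inj (S T : aiSemiringType) (f : S -> T) :
  ai_hom f -> injective f -> class_le (Var S) (Var T).
Proof.
move=> [fD fM] f_inj.
have hA : subalg (range f).
  split; first by case: (@ai_inhabited S) => x; exists (f x), x.
    by move=> _ _ [x _ <-] [y _ <-]; exists (x + y).
  by move=> _ _ [x _ <-] [y _ <-]; exists (mul x y).
have ex (y : subalg_type hA) : exists x, f x = val y.
  by case: (set_valP y) => x _ fx; exists x.
pose g y := sval (cid (ex y)).
have gK y : f (g y) = val y by exact: svalP (cid (ex y)).
apply: Var_smallest; first exact: Var_variety.
apply: (variety_img (Var_variety T) (f := g)); first split.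
- by move=> x y; apply: f_inj; rewrite fD !gK subalg_addE.
- by move=> x y; apply: f_inj; rewrite fM !gK subalg_mulE.
- move=> x; exists (exist _ (f x) (mem_set (imageT f x))).
  by apply: f_inj; rewrite gK.
- exact: variety_sub (Var_variety T) _ _ _ (@Var_self T).
Qed.

Lemma nesum_const (S : aiSemiringType) (I : finType) (i0 : I) (x : S) :
  nesum i0 (fun=> x) = x.
Proof. by apply: lub_eq => z; rewrite nesum_lub; split=> [/(_ i0)|]. Qed.

(** As [s] is onto, [F \o s] and [F] take the same values, so both sums have the same upper
    bounds. *)
Lemma nesum_reindex (S : aiSemiringType) (I J : finType) (i0 : I) (j0 : J)
    (s : J -> I) (r : I -> J) (F : I -> S) :
  cancel r s -> nesum j0 (F \o s) = nesum i0 F.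
Proof.
move=> rK; apply: lub_eq => z; rewrite !nesum_lub; split=> h i /=.
  by have := h (r i); rewrite /= rK.
exact: h.
Qed.

Lemma class_le_Var_const_mx (S : aiSemiringType) n :
  class_le (Var S) (Var (ai_matrix S n.+1)).
Proof.
apply: (@class_le_Var_inj _ _ (fun x => const_mx x : ai_matrix S n.+1)).
  split=> x y; apply/matrixP => i j.
    by rewrite ai_matrix_addE !mxE.
  (* By idempotency the entry [x * y] is a sum of [n.+1] copies of itself. *)
  rewrite ai_matrix_mulE mxE -[LHS](nesum_const i).
  by congr nesum; apply: funext => k; rewrite !mxE.
by move=> x y /matrixP/(_ ord0 ord0); rewrite !mxE.
Qed.

Lemma class_le_Var_mxsub (S : aiSemiringType) m n
    (s : 'I_m -> 'I_n) (r : 'I_n -> 'I_m) :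
  cancel r s -> class_le (Var (ai_matrix S n)) (Var (ai_matrix S m)).
Proof.
move=> rK.
apply: (@class_le_Var_inj _ _
  (fun A : ai_matrix S n => mxsub s s A : ai_matrix S m)).
  split=> A B; apply/matrixP => i j.
    by rewrite ai_matrix_addE !mxE.
  rewrite ai_matrix_mulE mxE ai_matrix_mulE -(nesum_reindex _ i _ rK).
  by congr nesum; apply: funext => k; rewrite !mxE.
(* The entry of [A] at [(i, j)] reappears at [(r i, r j)]. *)
move=> A B /matrixP AB; apply/matrixP => i j.
by have := AB (r i) (r j); rewrite !mxE !rK.
Qed.

Theorem corollary2p6 (S : aiSemiringType) :
  class_le (Var S) (Var (ai_matrix S 2)) /\
  forall n : nat, (2 <= n)%N ->
    class_le (Var (ai_matrix S n)) (Var (ai_matrix S n.+1)).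
Proof.
split=> [|[//|n] _]; first exact: class_le_Var_const_mx.
(* [inord] keeps every index but the last, which is out of range and goes to the default [ord0];
   [lift ord_max] is the inclusion. *)
apply: (@class_le_Var_mxsub _ _ _ (fun i => inord i) (lift ord_max)) => i.
by rewrite lift_max inord_val.
Qed.
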